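(* Let $\lambda>0$ and let $\Phi=U\Sigma V^\top$ be a singular value decomposition of $\Phi\in\mathbb R^{n_1\times m_1}$. Let $\sigma_1,\dots,\sigma_r>0$ be the nonzero singular values of $\Phi$ and $u_1,\dots,u_r$ the corresponding left singular vectors. For $\mathbf f\in\mathbb R^{n_1}$, write $$\mathbf f=\sum_{i=1}^r\alpha_iu_i+\mathbf f_\perp,\qquad \mathbf f_\perp\perp\operatorname{Range}(\Phi),$$ where $\alpha_i=\langle\mathbf f,u_i\rangle$. Then $$\widetilde{\mathbf f}_\lambda=\sum_{i=1}^r\frac{\sigma_i^2}{\sigma_i^2+\lambda}\,\alpha_iu_i,$$ and $$\|\mathbf f-\widetilde{\mathbf f}_\lambda\|_2^2=\sum_{i=1}^r\left(\frac{\lambda}{\sigma_i^2+\lambda}\right)^2|\alpha_i|^2+\|\mathbf f_\perp\|_2^2 .$$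
   Context: Here $\Phi\in\mathbb R^{n_1\times m_1}$ is the basis evaluation matrix $\Phi_{ij}=\varphi_j(\mathbf x_i)$ of fixed real-valued basis functions $\varphi_1,\dots,\varphi_{m_1}$ at observation points $\mathbf x_1,\dots,\mathbf x_{n_1}$. For $\lambda>0$ and a sampled input vector $\mathbf f\in\mathbb R^{n_1}$, the regularized reconstruction is $$\widetilde{\mathbf f}_\lambda=H_\lambda\mathbf f,\qquad H_\lambda=\Phi(\Phi^\top\Phi+\lambda I)^{-1}\Phi^\top .$$ $\|\cdot\|_2$ and $\langle\cdot,\cdot\rangle$ are the Euclidean norm and inner product. *)

(* Defs.v *)
From HB Require Import structures.
From mathcomp Require Import all_boot all_order all_algebra.
From mathcomp Require Import reals.

Set Implicit Arguments.
Unset Strict Implicit.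
Unset Printing Implicit Defensive.

Import Order.TTheory GRing.Theory Num.Theory.
Local Open Scope ring_scope.

Definition inner (R : realType) (n : nat) (v w : 'cV[R]_n) : R :=
  \sum_(i < n) v i 0 * w i 0.

(* The canonical norm `|v| on matrices in MathComp-Analysis is the sup norm. *)
Definition norm2 (R : realType) (n : nat) (v : 'cV[R]_n) : R :=
  Num.sqrt (inner v v).

Definition orthogonal_to_range (R : realType) (n m : nat)
    (A : 'M[R]_(n, m)) (v : 'cV[R]_n) : Prop :=
  forall w : 'cV[R]_m, inner v (A *m w) = 0.

Definition basis_matrix (R : realType) (X : Type) (n m : nat)
    (phi : 'I_m -> X -> R) (x : 'I_n -> X) : 'M[R]_(n, m) :=
  \matrix_(i < n, j < m) phi j (x i).

(* For lambda > 0 the matrix being inverted is positive definite, so the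
   junk value of invmx on singular matrices plays no role. *)
Definition smoother (R : realType) (n m : nat) (A : 'M[R]_(n, m))
    (lambda : R) : 'M[R]_n :=
  A *m invmx (A^T *m A + lambda%:M) *m A^T.

Definition reconstruction (R : realType) (n m : nat) (A : 'M[R]_(n, m))
    (lambda : R) (f : 'cV[R]_n) : 'cV[R]_n :=
  smoother A lambda *m f.

Definition orthogonal_mx (R : realType) (n : nat) (Q : 'M[R]_n) : Prop :=
  Q^T *m Q = 1%:M.

(* The k-th diagonal entry of a rectangular matrix, k < min(n, m). *)
Definition diag_entry (R : realType) (n m : nat) (S : 'M[R]_(n, m))
    (k : 'I_(minn n m)) : R :=
  S (widen_ord (geq_minl n m) k) (widen_ord (geq_minr n m) k).

(* Full singular value decomposition; the singular values are the diagonal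
   entries of S, with multiplicity, in no prescribed order. *)
Definition is_svd (R : realType) (n m : nat) (A : 'M[R]_(n, m))
    (U : 'M[R]_n) (S : 'M[R]_(n, m)) (V : 'M[R]_m) : Prop :=
  [/\ orthogonal_mx U, orthogonal_mx V, is_diag_mx S,
      forall k : 'I_(minn n m), 0 <= diag_entry S k
    & A = U *m S *m V^T].

Definition left_singular_vector (R : realType) (n m : nat) (U : 'M[R]_n)
    (k : 'I_(minn n m)) : 'cV[R]_n :=
  col (widen_ord (geq_minl n m) k) U.

(* e_0, ..., e_(r-1) are, without repetition, the positions on the diagonal
   of S of the nonzero singular values. *)
Definition enumerates_nonzero (R : realType) (n m : nat) (S : 'M[R]_(n, m))
    (r : nat) (e : 'I_r -> 'I_(minn n m)) : Prop :=
  injective e /\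
  forall k : 'I_(minn n m), diag_entry S k != 0 <-> exists i : 'I_r, e i = k.

(* Main.v *)
Require Import Defs.
From HB Require Import structures.
From mathcomp Require Import all_boot all_order all_algebra.
From mathcomp Require Import reals.

Set Implicit Arguments.
Unset Strict Implicit.
Unset Printing Implicit Defensive.

Import Order.TTheory GRing.Theory Num.Theory.
Local Open Scope ring_scope.

(** The smoother acts diagonally on singular pairs.  If [A v = s u] and
    [A^T u = s v], then [v] is an eigenvector of [A^T A + lambda I] with
    eigenvalue [s^2 + lambda]; hence [H u = A (A^T A + lambda I)^-1 (s v) =
    s^2 / (s^2 + lambda) u].  And [H] kills every vector killed by [A^T].
    A singular value decomposition provides such pairs ([svd_singular_pair]),
    so the formula for the reconstruction follows by linearity once
    [A^T fperp = 0] is known.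

    That last fact is what the decomposition of [f] encodes: its coefficients
    are the inner products of [f] with the orthonormal [u_i], so taking the
    inner product of the decomposition with [u_j] forces [<fperp, u_j> = 0].
    The [u_j] attached to the nonzero singular values span the range of [A],
    so [fperp] is orthogonal to it ([svd_tr_mul_eq0]).

    Finally [1 - s^2 / (s^2 + lambda) = lambda / (s^2 + lambda)], so the
    residual is an explicit combination of the [u_i] plus [fperp], and its
    squared norm is given by Pythagoras ([inner_sum_orthonormal]). *)

Section Inner.

Variables (R : realType) (n : nat).
Implicit Types (a : R) (v w : 'cV[R]_n).

Lemma inner_mxE v w : inner v w = (v^T *m w) 0 0.
Proof. by rewrite mxE; apply: eq_bigr => i _; rewrite mxE. Qed.

Lemma innerC v w : inner v w = inner w v.
Proof. by apply: eq_bigr => i _; rewrite mulrC. Qed.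

Lemma innerDl v1 v2 w : inner (v1 + v2) w = inner v1 w + inner v2 w.
Proof. by rewrite !inner_mxE linearD mulmxDl mxE. Qed.

Lemma innerZl a v w : inner (a *: v) w = a * inner v w.
Proof. by rewrite !inner_mxE linearZ -scalemxAl mxE. Qed.

Lemma inner_suml (I : finType) (v : I -> 'cV[R]_n) w :
  inner (\sum_i v i) w = \sum_i inner (v i) w.
Proof.
rewrite inner_mxE linear_sum mulmx_suml summxE.
by apply: eq_bigr => i _; rewrite inner_mxE.
Qed.

Lemma inner_ge0 v : 0 <= inner v v.
Proof. by apply: sumr_ge0 => i _; rewrite -expr2 sqr_ge0. Qed.

Lemma inner_eq0 v : inner v v = 0 -> v = 0.
Proof.
move=> /eqP; rewrite psumr_eq0 => [|i _]; last by rewrite -expr2 sqr_ge0.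
move=> /allP v0; apply/matrixP => i j; rewrite ord1 mxE.
by have := v0 i (mem_index_enum i); rewrite /= mulf_eq0 orbb => /eqP.
Qed.

Lemma sqr_norm2 v : norm2 v ^+ 2 = inner v v.
Proof. by rewrite sqr_sqrtr ?inner_ge0. Qed.

Definition orthonormal (I : finType) (u : I -> 'cV[R]_n) : Prop :=
  forall i j, inner (u i) (u j) = (i == j)%:R.

Lemma inner_sum_orthonormal_l (I : finType) (u : I -> 'cV[R]_n)
    (c : I -> R) (j : I) :
  orthonormal u -> inner (\sum_i c i *: u i) (u j) = c j.
Proof.
move=> u_on; rewrite inner_suml (bigD1 j) //= innerZl u_on eqxx mulr1.
by rewrite big1 ?addr0 // => i /negPf ij; rewrite innerZl u_on ij mulr0.
Qed.

(** Pythagoras: all the cross terms vanish. *)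
Lemma inner_sum_orthonormal (I : finType) (u : I -> 'cV[R]_n)
    (c : I -> R) (g : 'cV[R]_n) :
  orthonormal u -> (forall i, inner g (u i) = 0) ->
  inner (\sum_i c i *: u i + g) (\sum_i c i *: u i + g)
    = \sum_i c i ^+ 2 + inner g g.
Proof.
move=> u_on g_u; set s := \sum_i c i *: u i.
have s_g : inner s g = 0.
  by rewrite inner_suml big1 // => i _; rewrite innerZl innerC g_u mulr0.
rewrite innerDl innerC innerDl [X in _ + X]innerC innerDl.
rewrite s_g [inner g s]innerC s_g addr0 add0r; congr (_ + _).
rewrite [LHS]inner_suml; apply: eq_bigr => i _.
by rewrite innerZl innerC inner_sum_orthonormal_l.
Qed.

End Inner.

Section Smoother.

Variables (R : realType) (n m : nat) (A : 'M[R]_(n, m)) (lambda : R).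
Hypothesis lambda_gt0 : 0 < lambda.

(** For [w] in the kernel, [0 = <w, (A^T A + lambda I) w>
    = |A w|^2 + lambda |w|^2], and both terms are nonnegative. *)
Lemma regularized_gram_unitmx : A^T *m A + lambda%:M \in unitmx.
Proof.
rewrite -unitmx_tr -row_free_unit -kermx_eq0; apply/rowV0P => w /sub_kermxP.
move=> /(congr1 trmx); rewrite trmx_mul trmxK trmx0 => Mw.
apply: trmx_inj; rewrite trmx0; apply: inner_eq0.
have : inner (A *m w^T) (A *m w^T) + lambda * inner w^T w^T = 0.
  transitivity ((w *m ((A^T *m A + lambda%:M) *m w^T)) 0 0).
    rewrite mulmxDl mul_scalar_mx mulmxDr -scalemxAr [RHS]mxE.
    by rewrite [X in _ = _ + X]mxE !inner_mxE trmx_mul !trmxK !mulmxA.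
  by rewrite Mw mulmx0 mxE.
move/eqP; rewrite paddr_eq0 ?inner_ge0 ?mulr_ge0 ?inner_ge0 1?ltW //.
by case/andP => _; rewrite mulf_eq0 gt_eqF //= => /eqP.
Qed.

Definition singular_pair (s : R) (u : 'cV[R]_n) (v : 'cV[R]_m) : Prop :=
  A *m v = s *: u /\ A^T *m u = s *: v.

(** Invertibility turns [(A^T A + lambda I) v = (s^2 + lambda) v] into
    [(A^T A + lambda I)^-1 v = (s^2 + lambda)^-1 v]; the two outer factors of
    the smoother contribute one [s] each. *)
Lemma smoother_singular_pair (s : R) (u : 'cV[R]_n) (v : 'cV[R]_m) :
  singular_pair s u v ->
  smoother A lambda *m u = (s ^+ 2 / (s ^+ 2 + lambda)) *: u.
Proof.
case=> Av Au; have d_neq0 : s ^+ 2 + lambda != 0.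
  by rewrite gt_eqF // ltr_wpDl ?sqr_ge0.
have Mv : (A^T *m A + lambda%:M) *m v = (s ^+ 2 + lambda) *: v.
  rewrite mulmxDl mul_scalar_mx -mulmxA Av -scalemxAr Au scalerA -expr2.
  by rewrite scalerDl.
have iMv : invmx (A^T *m A + lambda%:M) *m v = (s ^+ 2 + lambda)^-1 *: v.
  apply: (scalerI d_neq0); rewrite scalemxAr -Mv.
  by rewrite (mulKmx regularized_gram_unitmx) scalerA divff ?scale1r.
rewrite /smoother -!mulmxA Au -!scalemxAr iMv -scalemxAr Av !scalerA.
by congr (_ *: _); rewrite expr2 mulrAC.
Qed.

Lemma smoother_tr_mul_eq0 (g : 'cV[R]_n) :
  A^T *m g = 0 -> smoother A lambda *m g = 0.
Proof. by move=> Ag; rewrite /smoother -mulmxA Ag mulmx0. Qed.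

End Smoother.

Section SVD.

Variables (R : realType) (n m : nat) (A : 'M[R]_(n, m)).
Variables (U : 'M[R]_n) (S : 'M[R]_(n, m)) (V : 'M[R]_m).
Hypothesis svdA : is_svd A U S V.

Lemma diag_mul_delta (k : 'I_(minn n m)) :
  S *m delta_mx (widen_ord (geq_minr n m) k) 0
    = diag_entry S k *: delta_mx (widen_ord (geq_minl n m) k) 0 :> 'cV_n.
Proof.
case: svdA => _ _ /is_diag_mxP S_diag _ _; rewrite -colE.
apply/matrixP => i j; rewrite !mxE ord1 eqxx andbT.
have [->|ik] := eqVneq; first by rewrite mulr1.
by rewrite mulr0 S_diag.
Qed.

Lemma tr_diag_mul_delta (k : 'I_(minn n m)) :
  S^T *m delta_mx (widen_ord (geq_minl n m) k) 0
    = diag_entry S k *: delta_mx (widen_ord (geq_minr n m) k) 0 :> 'cV_m.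
Proof.
case: svdA => _ _ /is_diag_mxP S_diag _ _; rewrite -colE.
apply/matrixP => i j; rewrite !mxE ord1 eqxx andbT.
have [->|ik] := eqVneq; first by rewrite mulr1.
by rewrite mulr0 S_diag // eq_sym.
Qed.

(** Orthogonality of [U] and [V] turns singular vectors into standard basis
    vectors, which reduces the claim to the diagonal matrix [S]. *)
Lemma svd_singular_pair (k : 'I_(minn n m)) :
  singular_pair A (diag_entry S k) (left_singular_vector U k)
    (col (widen_ord (geq_minr n m) k) V).
Proof.
case: svdA => UU VV _ _ ->; rewrite /left_singular_vector !colE; split.
  by rewrite -!mulmxA (mulmxA V^T) VV mul1mx diag_mul_delta -scalemxAr.
rewrite !trmx_mul trmxK -!mulmxA (mulmxA U^T) UU mul1mx.
by rewrite tr_diag_mul_delta -scalemxAr.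
Qed.

Lemma left_singular_vector_orthonormal :
  orthonormal (@left_singular_vector R n m U).
Proof.
case: svdA => UU _ _ _ _ k l.
have := congr1 (fun M : 'M_n => M (widen_ord (geq_minl n m) k)
                                 (widen_ord (geq_minl n m) l)) UU.
rewrite !mxE => <-; apply: eq_bigr => i _; by rewrite !mxE.
Qed.

(** In the coordinates given by [U], applying [A^T = V S^T U^T] multiplies the
    entries of [U^T g] by the singular values: an entry survives only when its
    singular value is nonzero, and there [<g, u_k>] vanishes. *)
Lemma svd_tr_mul_eq0 (g : 'cV[R]_n) :
  (forall k, diag_entry S k != 0 -> inner g (left_singular_vector U k) = 0) ->
  A^T *m g = 0.
Proof.
case: svdA => _ _ /is_diag_mxP S_diag _ -> g_u.
rewrite !trmx_mul trmxK -!mulmxA.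
suff -> : S^T *m (U^T *m g) = 0 by rewrite mulmx0.
apply/matrixP => j z; rewrite ord1 {z} !mxE big1 // => i _; rewrite mxE.
have [ij|/S_diag ->] := eqVneq (i : nat) j; last by rewrite mul0r.
have k_lt : (i < minn n m)%N by rewrite leq_min ltn_ord ij ltn_ord.
pose k := Ordinal k_lt.
have -> : i = widen_ord (geq_minl n m) k by apply: val_inj.
have -> : j = widen_ord (geq_minr n m) k by apply: val_inj.
rewrite -/(diag_entry S k).
have [->|/g_u gk] := eqVneq (diag_entry S k) 0; first by rewrite mul0r.
rewrite -[X in _ * X](_ : inner g (left_singular_vector U k) = _).
  by rewrite gk mulr0.
by rewrite innerC mxE; apply: eq_bigr => l _; rewrite !mxE.
Qed.

End SVD.

Lemma tr_mul_eq0_orthogonal (R : realType) (n m : nat) (A : 'M[R]_(n, m))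
    (g : 'cV[R]_n) :
  A^T *m g = 0 -> orthogonal_to_range A g.
Proof.
by move=> Ag w; rewrite innerC inner_mxE trmx_mul -mulmxA Ag mulmx0 mxE.
Qed.

Theorem proposition3p3 (R : realType) (X : Type) (n1 m1 : nat)
    (phi : 'I_m1 -> X -> R) (x : 'I_n1 -> X) (lambda : R)
    (U : 'M[R]_n1) (S : 'M[R]_(n1, m1)) (V : 'M[R]_m1)
    (r : nat) (e : 'I_r -> 'I_(minn n1 m1)) (f fperp : 'cV[R]_n1) :
  let Phi := basis_matrix phi x in
  let sigma := fun i : 'I_r => diag_entry S (e i) in
  let u := fun i : 'I_r => left_singular_vector U (e i) in
  let alpha := fun i : 'I_r => inner f (u i) in
  0 < lambda ->
  is_svd Phi U S V ->
  enumerates_nonzero S e ->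
  f = \sum_(i < r) alpha i *: u i + fperp ->
  [/\ orthogonal_to_range Phi fperp,
      reconstruction Phi lambda f =
        \sum_(i < r) (sigma i ^+ 2 / (sigma i ^+ 2 + lambda) * alpha i) *: u i
    & norm2 (f - reconstruction Phi lambda f) ^+ 2 =
        \sum_(i < r) (lambda / (sigma i ^+ 2 + lambda)) ^+ 2 * `|alpha i| ^+ 2
        + norm2 fperp ^+ 2].
Proof.
move=> Phi sigma u alpha lambda_gt0 svdPhi [e_inj e_nz] f_eq.
have u_on : orthonormal u.
  by move=> i j; rewrite (left_singular_vector_orthonormal svdPhi) inj_eq.
have fperp_u i : inner fperp (u i) = 0.
  have : alpha i = alpha i + inner fperp (u i).
    by rewrite {1}/alpha {1}f_eq innerDl inner_sum_orthonormal_l.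
  by move/eqP; rewrite -subr_eq0 opprD addrA subrr sub0r oppr_eq0 => /eqP.
have Phi_fperp : Phi^T *m fperp = 0.
  apply: (svd_tr_mul_eq0 svdPhi) => k /e_nz [i <-]; exact: fperp_u.
have rec_eq : reconstruction Phi lambda f =
    \sum_(i < r) (sigma i ^+ 2 / (sigma i ^+ 2 + lambda) * alpha i) *: u i.
  rewrite /reconstruction {1}f_eq mulmxDr (smoother_tr_mul_eq0 _ Phi_fperp) addr0.
  rewrite mulmx_sumr; apply: eq_bigr => i _; rewrite -scalemxAr.
  rewrite (smoother_singular_pair lambda_gt0 (svd_singular_pair svdPhi (e i))).
  by rewrite scalerA mulrC.
split=> //; first exact: tr_mul_eq0_orthogonal.
have res_eq : f - reconstruction Phi lambda f =
    \sum_(i < r) (lambda / (sigma i ^+ 2 + lambda) * alpha i) *: u i + fperp.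
  rewrite rec_eq {1}f_eq addrAC -sumrB; congr (_ + _).
  apply: eq_bigr => i _; rewrite -scalerBl; congr (_ *: _).
  have d_neq0 : sigma i ^+ 2 + lambda != 0.
    by rewrite gt_eqF // ltr_wpDl ?sqr_ge0.
  rewrite -{1}[alpha i]mul1r -mulrBl -{1}(divff d_neq0) -mulrBl.
  by rewrite [_ + lambda]addrC addrK.
rewrite !sqr_norm2 res_eq inner_sum_orthonormal //; congr (_ + _).
by apply: eq_bigr => i _; rewrite exprMn real_normK ?num_real.
Qed.
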